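(* Let $k$ be a field, $R=k[x,y,z]$ with the standard grading, and let $s\geq 3$ be an integer. Let $I\subset R$ be a homogeneous ideal of grade $3$ such that $R/I$ is compressed with $\operatorname{Soc}(R/I)\cong k(-s)\oplus k(-2s+1)$. Then $$\dim_k\operatorname{Tor}_1^R(R/I,k)_{s+1}\leq s+2 .$$
   Context: The isomorphism $\operatorname{Soc}(R/I)\cong k(-s)\oplus k(-2s+1)$ is as graded vector spaces: one basis element in degree $s$ and one in degree $2s-1$. $R/I$ compressed means that, with $c_\ell=\dim_k \operatorname{Soc}(R/I)_\ell$ (so $c_s=c_{2s-1}=1$ and all others are $0$), $\dim_k (R/I)_i=\min\{\binom{2+i}{i},\ \sum_{\ell=0}^{2s-1} c_\ell\binom{2+\ell-i}{\ell-i}\}$ for $0\le i\le 2s-1$, where binomials with $\ell<i$ are $0$. *)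

(* Defs.v *)
From HB Require Import structures.
From mathcomp Require Export all_boot all_order all_algebra.
From mathcomp Require Export generic_quotient ring_quotient.
From mathcomp.multinomials Require Export mpoly.

Set Implicit Arguments.
Unset Strict Implicit.
Unset Printing Implicit Defensive.

Import GRing.Theory.
Local Open Scope ring_scope.
Local Open Scope quotient_scope.

Section QuotientLmodule.

Context (k : fieldType) (n : nat) (I : idealr {mpoly k[n]}).

Definition quot_scale (c : k) (a : {ideal_quot I}) : {ideal_quot I} :=
  \pi_{ideal_quot I} c%:MP * a.

Fact quot_scaleA a b v : quot_scale a (quot_scale b v) = quot_scale (a * b) v.
Proof. by rewrite /quot_scale mulrA -rmorphM /= -mpolyCM. Qed.

Fact quot_scale1 : left_id 1 quot_scale.
Proof. by move=> v; rewrite /quot_scale mpolyC1 rmorph1 mul1r. Qed.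

Fact quot_scaleDr : right_distributive quot_scale +%R.
Proof. by move=> a u v; rewrite /quot_scale mulrDr. Qed.

Fact quot_scaleDl v : {morph quot_scale^~ v : a b / a + b}.
Proof. by move=> a b; rewrite /quot_scale mpolyCD rmorphD mulrDl. Qed.

HB.instance Definition _ := GRing.Zmodule_isLmodule.Build k {ideal_quot I}
  quot_scaleA quot_scale1 quot_scaleDr quot_scaleDl.

End QuotientLmodule.

(* [S] stands for a [k]-subspace of the possibly infinite-dimensional [V]. *)
Definition kbasis (k : fieldType) (V : lmodType k) (S : V -> Prop) (m : nat)
    (e : 'I_m -> V) : Prop :=
  (forall i, S (e i)) /\
  forall v, S v -> exists! c : 'rV[k]_m, v = \sum_i c 0 i *: e i.

Definition kdim (k : fieldType) (V : lmodType k) (S : V -> Prop) (m : nat) :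
    Prop :=
  exists e : 'I_m -> V, kbasis S e.

Definition homogeneous_ideal (k : fieldType) (n : nat)
    (I : idealr {mpoly k[n]}) : Prop :=
  forall f, f \in I -> forall d, pihomog mdeg d f \in I.

Definition in_generated (R : comNzRingType) (a : seq R) (f : R) : Prop :=
  exists c : 'I_(size a) -> R, f = \sum_(j < size a) c j * a`_j.

Definition regular_sequence (R : comNzRingType) (a : seq R) : Prop :=
  (forall i, (i < size a)%N -> forall f,
     in_generated (take i a) (a`_i * f) -> in_generated (take i a) f) /\
  ~ in_generated a 1.

Definition has_grade (R : comNzRingType) (I : idealr R) (g : nat) : Prop :=
  (exists a : seq R, [/\ regular_sequence a, {subset a <= I} & size a = g]) /\
  (forall a : seq R, regular_sequence a -> {subset a <= I} -> (size a <= g)%N).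

(* The component $(R/I)_d$. *)
Definition quot_deg (k : fieldType) (n : nat) (I : idealr {mpoly k[n]})
    (d : nat) (a : {ideal_quot I}) : Prop :=
  exists2 f : {mpoly k[n]}, f \is d.-homog & a = \pi_{ideal_quot I} f.
Arguments quot_deg {k n} I d a.

(* The elements killed by the homogeneous maximal ideal, which consists of the
   polynomials with zero constant term. *)
Definition socle (k : fieldType) (n : nat) (I : idealr {mpoly k[n]})
    (a : {ideal_quot I}) : Prop :=
  forall f : {mpoly k[n]}, f@_0%MM = 0 -> \pi_{ideal_quot I} f * a = 0.
Arguments socle {k n} I a.

Definition socle_deg (k : fieldType) (n : nat) (I : idealr {mpoly k[n]})
    (d : nat) (a : {ideal_quot I}) : Prop :=
  socle I a /\ quot_deg I d a.
Arguments socle_deg {k n} I d a.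

(* $Soc(R/I)$ is isomorphic to the direct sum of the $k(-d_i)$, as a graded
   vector space. *)
Definition socle_shifts (k : fieldType) (n : nat) (I : idealr {mpoly k[n]})
    (m : nat) (d : m.-tuple nat) : Prop :=
  exists e : 'I_m -> {ideal_quot I},
    kbasis (socle I) e /\ forall i, quot_deg I (tnth d i) (e i).

(* [c] is the Hilbert function of the socle and [t] its top degree. *)
Definition compressed (k : fieldType) (I : idealr {mpoly k[3]}) : Prop :=
  exists (c : nat -> nat) (t : nat),
    [/\ forall l, kdim (socle_deg I l) (c l),
        c t <> 0%N,
        forall l, (t < l)%N -> c l = 0%N
      & forall i, (i <= t)%N ->
          kdim (quot_deg I i)
            (minn 'C(2 + i, i)
                  (\sum_(0 <= l < t.+1 | (i <= l)%N)
                     c l * 'C(2 + (l - i), l - i))%N)].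

(* Homogeneity for an integral degree; a negative degree forces [f = 0]. *)
Definition homogz (k : fieldType) (n : nat) (d : int) (f : {mpoly k[n]}) :
    Prop :=
  forall m, m \in msupp f -> (mdeg m)%:Z = d.

(* A resolution by finitely generated graded free modules
     ... -> F_2 -> F_1 -> F_0 -> R/I -> 0,  F_i = \bigoplus_a R(- gdeg i a).
   Elements of F_i are row vectors, on which the differential acts by right
   multiplication; [gaug] lists the images of the basis of F_0 in R/I. *)
Record graded_free_resolution (k : fieldType) (n : nat)
    (I : idealr {mpoly k[n]}) := GradedFreeResolution {
  grank : nat -> nat;
  gdeg : forall i, 'I_(grank i) -> int;
  gdiff : forall i, 'M[{mpoly k[n]}]_(grank i.+1, grank i);
  gaug : 'I_(grank 0) -> {ideal_quot I};
  gdiff_homog : forall i a b, homogz (gdeg a - gdeg b) (gdiff i a b);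
  gaug_homog : forall b,
    exists2 f, homogz (gdeg b) f & gaug b = \pi_{ideal_quot I} f;
  gaug_surj : forall q : {ideal_quot I}, exists v : 'rV[{mpoly k[n]}]_(grank 0),
    q = \sum_b \pi_{ideal_quot I} (v 0 b) * gaug b;
  gexact0 : forall v : 'rV[{mpoly k[n]}]_(grank 0),
    \sum_b \pi_{ideal_quot I} (v 0 b) * gaug b = 0 <->
    exists w, v = w *m gdiff 0;
  gexactS : forall i (v : 'rV[{mpoly k[n]}]_(grank i.+1)),
    v *m gdiff i = 0 <-> exists w, v = w *m gdiff i.+1
}.

Section Tor.

Context (k : fieldType) (n : nat) (I : idealr {mpoly k[n]}).
Variable F : graded_free_resolution I.

(* The differential of the complex of [k]-vector spaces [F \otimes_R k]. *)
Definition tor_diff (i : nat) : 'M[k]_(grank F i.+1, grank F i) :=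
  map_mx (mcoeff 0%MM) (gdiff F i).

(* Its row space is the degree [j] component of [F_i \otimes_R k]. *)
Definition tor_part (i : nat) (j : int) : 'M[k]_(grank F i) :=
  diag_mx (\row_a (gdeg a == j)%:R).

Definition tor_cycles (i : nat) (j : int) : 'M[k]_(grank F i) :=
  (tor_part i j :&:
     match i return 'M[k]_(grank F i) with
     | 0 => 1%:M
     | i'.+1 => kermx (tor_diff i')
     end)%MS.

Definition tor_boundaries (i : nat) (j : int) :
    'M[k]_(grank F i.+1, grank F i) :=
  tor_part i.+1 j *m tor_diff i.

Lemma tor_diffK i : tor_diff i.+1 *m tor_diff i = 0.
Proof.
rewrite /tor_diff -map_mxM /=; apply/row_matrixP => a.
rewrite -map_row row_mul row0.
suff -> : row a (gdiff F i.+1) *m gdiff F i = 0 by rewrite map_mx0.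
by apply/(gexactS (g := F)); exists (delta_mx 0 a); rewrite rowE.
Qed.

Lemma tor_boundaries_part i j : (tor_boundaries i j <= tor_part i j)%MS.
Proof.
apply/submxP; exists (tor_boundaries i j); apply/matrixP => a b.
rewrite /tor_boundaries /tor_part -mulmxA !mul_diag_mx !mul_mx_diag !mxE.
have [ja|] := eqVneq (gdeg a) j; last by rewrite !mul0r.
have [jb|jNb] := eqVneq (gdeg b) j; first by rewrite mulr1.
rewrite !mulr0 mul1r; apply/memN_msupp_eq0/negP => /gdiff_homog.
by rewrite mdeg0 ja => /esym/eqP; rewrite subr_eq0 eq_sym (negPf jNb).
Qed.

Lemma tor_boundaries_cycles i j : (tor_boundaries i j <= tor_cycles i j)%MS.
Proof.
rewrite sub_capmx tor_boundaries_part /=; case: i => [|i]; first exact: submx1.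
by apply/sub_kermxP; rewrite /tor_boundaries -mulmxA tor_diffK mulmx0.
Qed.

(* The dimension of $Tor_i^R(R/I, k)_j = H_i(F \otimes_R k)_j$; the subtraction
   is not truncated, by [tor_boundaries_cycles]. *)
Definition tor_dim (i : nat) (j : int) : nat :=
  (\rank (tor_cycles i j) - \rank (tor_boundaries i j))%N.

End Tor.

(* Main.v *)
From HB Require Import structures.
Require Import Defs.
From mathcomp Require Import fraction ring zify.

(* Write [t = 2 s - 1]. The Hilbert function of [R/I] gives [dim I_s = s],
   [dim I_{s+1} = 3 s + 3] and [dim (R/I)_t = 1], and [Tor_1(R/I, k)_{s+1}]
   embeds into [I_{s+1} / R_1 I_s], so it is enough that
   [dim R_1 I_s >= 2 s + 1].

   Let [u : R_t -> k] be the linear form with kernel [I_t]. The socle degrees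
   force the forms [f] of degree [s] with [u (f R_{s-1}) = 0] to be [I_s]
   enlarged by the socle element of degree [s], hence of dimension [s + 1];
   counting dimensions, the pairing [u (w f)] on [R_{s-1} x R_s] is
   nondegenerate in [w]. Let [p] be a point where some [g] in [I_s] does not
   vanish, and let [l] and [m] be independent linear forms vanishing at [p] and
   [x] one with [x(p) = 1]. If [m v1 = l v2] with [v1, v2] in [I_s], then
   [v1 = l w] and [v2 = m w], so [u (w R_s) = 0] because [R_s] is spanned by
   [g] and the multiples of [l] and [m]; hence [w = 0]. So [m I_s + l I_s] has
   dimension [2 s], and it does not contain [x g]. Over a finite field there
   may be no such point, so [p] is taken over [k(T)], namely
   [(1 : T : T^(s+1))], at which no nonzero form of degree [s] vanishes. *)

Set Implicit Arguments.
Unset Strict Implicit.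
Unset Printing Implicit Defensive.

Import GRing.Theory.
Local Open Scope ring_scope.
Local Open Scope quotient_scope.

(** * Functionals on forms and substitution in polynomials *)

Definition coeff_form (R : comNzRingType) (n N : nat) (c : 'X_{1..n} -> R)
    (f : {mpoly R[n]}) : R :=
  \sum_(m : 'X_{1..n < N}) c m * f@_m.

Lemma coeff_form_linear (R : comNzRingType) n N c :
  linear_for *%R (@coeff_form R n N c).
Proof.
move=> a f g; rewrite /coeff_form mulr_sumr -big_split /=.
by apply: eq_bigr => m _; rewrite mcoeffD mcoeffZ mulrDr mulrCA.
Qed.
HB.instance Definition _ (R : comNzRingType) n N c :=
  GRing.isLinear.Build R {mpoly R[n]} R *%R (@coeff_form R n N c)
    (@coeff_form_linear R n N c).

Lemma coeff_formX (R : comNzRingType) n N c (m : 'X_{1..n}) :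
  (mdeg m < N)%N -> @coeff_form R n N c 'X_[m] = c m.
Proof.
move=> ltmN; rewrite /coeff_form (bigD1 (BMultinom ltmN)) //= mcoeffX eqxx.
rewrite mulr1 big1 ?addr0 // => m' /eqP ne; rewrite mcoeffX.
case: eqP => [e|]; last by rewrite mulr0.
by case: ne; apply/val_inj.
Qed.

(** Storing a functional by its values on monomials makes extension of scalars a mere change of
    coefficients. *)
Lemma coeff_form_map (R S : comNzRingType) (iota : {rmorphism R -> S}) n N c f :
  coeff_form N (fun m => iota (c m)) (map_mpoly iota f) =
    iota (@coeff_form R n N c f).
Proof.
rewrite /coeff_form rmorph_sum; apply: eq_bigr => m _.
by rewrite mcoeff_map_mpoly rmorphM.
Qed.

Lemma coeff_form_rep (k : comNzRingType) n d N
    (u : dhomog n k d -> k) : linear_for *%R u -> (d < N)%N ->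
  {c : 'X_{1..n} -> k | forall f : dhomog n k d, coeff_form N c f = u f}.
Proof.
move=> lu dN.
pose ua := GRing.isLinear.Build k (dhomog n k d) k *%R u lu.
pose ul : {linear dhomog n k d -> k | *%R} := HB.pack u ua.
exists (fun m => u (indhomog d 'X_[m])) => f.
have ef : f = \sum_(m <- msupp f) f@_m *: indhomog d 'X_[m].
  apply/val_inj; rewrite [LHS]mpolyE raddf_sum /= !big_seq; apply: eq_bigr => m mf.
  congr (_ *: _); rewrite /indhomog val_insubd dhomogX.
  by rewrite (dhomog_mf (valP f) mf) eqxx.
rewrite {2}ef -[u _]/(ul _) (linear_sum ul) {1}[mpoly_of_dhomog f]mpolyE.
rewrite linear_sum !big_seq.
apply: eq_bigr => m mf; rewrite linearZ_LR (linearZ_LR ul) /= coeff_formX //.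
by rewrite (dhomog_mf (valP f) mf).
Qed.

(** The polynomials with such an expansion contain the constants and the variables and are closed
    under sums and products. It serves as division by a linear form, evaluation at a point and
    extraction of the constant term. *)
Lemma mpoly_comp_congr (R : comNzRingType) n (q : n.-tuple {mpoly R[n]})
    (f : {mpoly R[n]}) :
  exists h : 'I_n -> {mpoly R[n]},
    f = f \mPo q + \sum_j ('X_j - tnth q j) * h j.
Proof.
pose D f := exists h : 'I_n -> {mpoly R[n]},
    f = f \mPo q + \sum_j ('X_j - tnth q j) * h j.
have DC c : D c%:MP.
  by exists (fun=> 0); rewrite comp_mpolyC big1 ?addr0 // => j _; rewrite mulr0.
have DD f1 f2 : D f1 -> D f2 -> D (f1 + f2).
  move=> [h1 e1] [h2 e2]; exists (fun j => h1 j + h2 j).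
  rewrite {1}e1 {1}e2 comp_mpolyD addrACA -big_split /=; congr (_ + _).
  by apply: eq_bigr => j _; rewrite mulrDr.
have DM f1 f2 : D f1 -> D f2 -> D (f1 * f2).
  move=> [h1 e1] [h2 e2]; exists (fun j => h1 j * f2 + (f1 \mPo q) * h2 j).
  rewrite {1}e1 mulrDl {1}e2 mulrDr rmorphM /= -addrA; congr (_ + _).
  rewrite mulr_sumr [X in _ + X]mulr_suml -big_split /=.
  by apply: eq_bigr => j _; ring.
have DX i : D 'X_i.
  exists (fun j => (j == i)%:R); rewrite comp_mpolyXU -tnth_nth (bigD1 i) //=.
  rewrite eqxx mulr1 big1 ?addr0 => [|j /negPf->]; last by rewrite mulr0.
  by rewrite addrC subrK.
rewrite -/(D f); elim/mpolyind: f => [|c m f _ _ Df]; first by rewrite -mpolyC0.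
apply: DD Df; rewrite -mul_mpolyC; apply: (DM) => //; rewrite mpolyXE_id.
apply: big_ind => [||i _]; [by rewrite -mpolyC1 | exact: DM |].
by elim: (m i) => [|e IH]; rewrite ?expr0 -?mpolyC1 // exprS; apply: (DM).
Qed.

(** Only the component of [h] of degree [d] contributes. This makes the cofactors from
    [mpoly_comp_congr] homogeneous. *)
Lemma pihomogMl (R : comNzRingType) n b d (l h : {mpoly R[n]}) :
  l \is b.-homog -> pihomog mdeg (b + d) (l * h) = l * pihomog mdeg d h.
Proof.
move=> hl; rewrite {1}(pihomog_partitionE (leqnn (mmeasure mdeg h))).
have ->: pihomog mdeg d h =
    \sum_(e < mmeasure mdeg h) pihomog mdeg d (pihomog mdeg e h).
  by rewrite -linear_sum -pihomog_partitionE.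
rewrite !mulr_sumr linear_sum; apply: eq_bigr => e _ /=.
have he := dhomogM hl (pihomogP mdeg e h).
have [->|ne] := eqVneq (e : nat) d.
  by rewrite (pihomog_dE (pihomogP _ _ _)); apply/pihomog_dE/dhomogM/pihomogP.
rewrite (pihomog_ne0 ne (pihomogP _ _ _)) mulr0 (pihomog_ne0 _ he) //.
by rewrite eqn_add2l.
Qed.

(** * Growth of a space of forms *)

Definition x0 : 'I_3 := @Ordinal 3 0 isT.
Definition x1 : 'I_3 := @Ordinal 3 1 isT.
Definition x2 : 'I_3 := @Ordinal 3 2 isT.

Lemma sum_ord3 (V : nmodType) (F : 'I_3 -> V) :
  \sum_(j < 3) F j = F x0 + F x1 + F x2.
Proof.
rewrite !big_ord_recr big_ord0 /= add0r.
by congr (F _ + F _ + F _); apply/val_inj.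
Qed.

Lemma comp_mpoly_line (R : comNzRingType) n d (p : 'I_n -> R) (i : 'I_n)
    (f : {mpoly R[n]}) :
  f \is d.-homog ->
  f \mPo [tuple p j *: 'X_i | j < n] = f.@[p] *: 'X_i ^+ d.
Proof.
move=> /dhomogP hf; rewrite comp_mpolyEX mevalE scaler_suml !big_seq.
apply: eq_bigr => m /hf dm; rewrite comp_mpolyX -scalerA; congr (_ *: _).
under [LHS]eq_bigr => j _ do rewrite tnth_mktuple exprZn.
by rewrite scaler_prod prodrXr -mdegE dm.
Qed.

(** Evaluation at [p] isolates [c]. What remains is a relation between multiples of two linear
    forms; its cofactor [w] vanishes because the pairing given by [u] is nondegenerate. *)
Lemma products_indep (K : fieldType) d n (g : 'I_n -> {mpoly K[3]})
    (u : {linear {mpoly K[3]} -> K | *%R}) (p : 'I_3 -> K) (j0 : 'I_n)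
    (al be : 'I_n -> K) (c : K) :
  (forall j, g j \is d.+1.-homog) ->
  (forall j h, h \is d.-homog -> u (g j * h) = 0) ->
  (forall w, w \is d.-homog ->
     (forall f, f \is d.+1.-homog -> u (w * f) = 0) -> w = 0) ->
  (forall e : 'I_n -> K, \sum_j e j *: g j = 0 -> forall j, e j = 0) ->
  p x0 = 1 -> (g j0).@[p] != 0 ->
  (\sum_j al j *: g j) * ('X_x2 - p x2 *: 'X_x0)
    + (\sum_j be j *: g j) * ('X_x1 - p x1 *: 'X_x0)
    + c *: ('X_x0 * g j0) = 0 ->
  [/\ forall j, al j = 0, forall j, be j = 0 & c = 0].
Proof.
move=> hg ug und gfree p0 gp.
set v2 := \sum_j al j *: g j; set v1 := \sum_j be j *: g j.
set l := 'X_x2 - _; set m := 'X_x1 - _ => rel.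
have lin i i' (e : K) : ('X_i - e *: 'X_i' : {mpoly K[3]}) \is 1.-homog.
  by apply: rpredB; [|apply: rpredZ]; rewrite dhomogX /= mdeg1.
have nz (i : 'I_3) (e : K) : i != x0 -> 'X_i - e *: 'X_x0 != 0 :> {mpoly K[3]}.
  move=> ix; apply/eqP => /(congr1 (mcoeff U_(i))) /eqP.
  rewrite mcoeffB mcoeffZ !mcoeffXU mcoeff0 eqxx (eq_sym x0) (negPf ix).
  by rewrite mulr0 subr0 oner_eq0.
have ev (e : K) i : e = p i -> ('X_i - e *: 'X_x0).@[p] = 0.
  by move=> ->; rewrite mevalB mevalZ !mevalXU p0 mulr1 subrr.
have c0 : c = 0.
  have /eqP := congr1 (meval p) rel; rewrite !mevalD mevalZ !mevalM.
  rewrite !ev // !mulr0 !add0r mevalXU p0 mul1r meval0 mulf_eq0 (negPf gp) orbF.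
  by move/eqP.
move: rel; rewrite c0 scale0r addr0 => rel.
have hv1 : v1 \is d.+1.-homog by apply: rpred_sum => j _; apply: rpredZ.
(* Substituting [q] restricts to the plane [l = 0], where [m] stays nonzero; so [v1] vanishes there
   and is divisible by [l]. *)
pose q := [tuple if j == x2 then p x2 *: 'X_x0 else 'X_j | j < 3]
  : 3.-tuple {mpoly K[3]}.
have qX i : 'X_i \mPo q = if i == x2 then p x2 *: 'X_x0 else 'X_i.
  by rewrite comp_mpolyXU -tnth_nth tnth_mktuple.
have v1q : v1 \mPo q = 0.
  have /eqP := congr1 (comp_mpoly q) rel.
  rewrite rmorphD !rmorphM !rmorphB /= !comp_mpolyZ !qX /= subrr mulr0 add0r.
  by rewrite comp_mpoly0 mulf_eq0 (negPf (nz x1 _ _)) // orbF => /eqP.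
have [h eh] := mpoly_comp_congr q v1.
have {h eh} [w hw v1E] : exists2 w, w \is d.-homog & v1 = l * w.
  exists (pihomog mdeg d (h x2)); first exact: pihomogP.
  rewrite -(pihomogMl _ _ (lin x2 x0 (p x2))) -(pihomog_dE hv1) {1}eh v1q add0r.
  by rewrite sum_ord3 !tnth_mktuple /= !subrr !mul0r !add0r.
have v2E : v2 = - (m * w).
  apply/eqP; rewrite -addr_eq0 -(mulrI_eq0 _ (mulfI (nz x2 (p x2) isT))).
  by rewrite -rel v1E -/l; apply/eqP; ring.
have u1 f : f \is d.-homog -> u (v1 * f) = 0.
  move=> hf; rewrite mulr_suml linear_sum big1 // => j _.
  by rewrite -scalerAl linearZ_LR /= ug ?mulr0.
have u2 f : f \is d.-homog -> u (v2 * f) = 0.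
  move=> hf; rewrite mulr_suml linear_sum big1 // => j _.
  by rewrite -scalerAl linearZ_LR /= ug ?mulr0.
(* Modulo [l] and [m], [f] is [f.@[p]] times a power of ['X_x0]; after multiplication by [w] the
   remaining terms are multiples of [v1] and [v2], which [u] kills. *)
have uw f : f \is d.+1.-homog -> u (w * f) = f.@[p] * u (w * 'X_x0 ^+ d.+1).
  move=> hf; have [h] := mpoly_comp_congr [tuple p j *: 'X_x0 | j < 3] f.
  rewrite (comp_mpoly_line _ _ hf) sum_ord3 !tnth_mktuple p0 scale1r subrr mul0r.
  rewrite add0r => /(congr1 (pihomog mdeg d.+1)); rewrite !linearD /= pihomog_dE //.
  rewrite !(@pihomogMl _ _ 1%N d) // => ef.
  rewrite {1}ef linearZ /= pihomog_dE; last first.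
    by rewrite -{2}[d.+1]mul1n; apply/dhomogMn; rewrite dhomogX /= mdeg1.
  rewrite !mulrDr !linearD /= -scalerAr linearZ_LR /= -/l -/m.
  have -> : w * (m * pihomog mdeg d (h x1)) = - (v2 * pihomog mdeg d (h x1)).
    by rewrite v2E; ring.
  have -> : w * (l * pihomog mdeg d (h x2)) = v1 * pihomog mdeg d (h x2).
    by rewrite v1E; ring.
  by rewrite linearN /= u1 ?u2 ?pihomogP // oppr0 !addr0.
have w0 : w = 0.
  apply: und => // f hf; rewrite uw //.
  have /eqP := uw _ (hg j0); rewrite mulrC ug // eq_sym mulf_eq0 (negPf gp) /=.
  by move=> /eqP ->; rewrite mulr0.
by split=> //; apply: gfree; rewrite -/v1 -/v2 ?v1E ?v2E w0 mulr0 ?oppr0.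
Qed.

Lemma mulX_homog (R : comNzRingType) n d (i : 'I_n) (f : dhomog n R d) :
  'X_i * val f \is d.+1.-homog.
Proof. by rewrite -add1n; apply: dhomogM (valP f); rewrite dhomogX /= mdeg1. Qed.

Definition mulX (R : comNzRingType) n d (i : 'I_n) (f : dhomog n R d) :=
  DHomog (mulX_homog i f).

Lemma mulX_linear (R : comNzRingType) n d i : linear (@mulX R n d i).
Proof.
by move=> c f g; apply/val_inj; rewrite /= mulrDr scalerAr.
Qed.
HB.instance Definition _ (R : comNzRingType) n d i :=
  GRing.isLinear.Build R (dhomog n R d) (dhomog n R d.+1) *:%R (@mulX R n d i)
    (@mulX_linear R n d i).

Definition mul_linear_forms (k : fieldType) n d
    (V : {vspace dhomog n.+1 k d}) : {vspace dhomog n.+1 k d.+1} :=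
  (\sum_i linfun (mulX i) @: V)%VS.

Lemma mulX_mem (k : fieldType) n d (V : {vspace dhomog n.+1 k d}) i f :
  f \in V -> mulX i f \in mul_linear_forms V.
Proof.
move=> fV; apply/(subvP (sumv_sup i (isT : true) (subvv _))).
by rewrite -[mulX i f]lfunE memv_img.
Qed.

Lemma mul_linear_formsP (k : fieldType) n d (V : {vspace dhomog n.+1 k d}) f :
  f \in mul_linear_forms V ->
  exists2 h : 'I_n.+1 -> dhomog n.+1 k d,
    forall i, h i \in V & val f = \sum_i 'X_i * val (h i).
Proof.
case/memv_sumP=> e eV ->.
have /fin_all_exists2[h hV he] i :
    exists2 h, h \in V & e i = linfun (mulX i) h.
  by case/memv_imgP: (eV i isT) => h; exists h.
exists h => //; rewrite raddf_sum; apply: eq_bigr => i _.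
by rewrite he lfunE.
Qed.

Definition kronecker_point (k : fieldType) d (j : 'I_3) : {fraction {poly k}} :=
  tofrac ('X ^+ nth 0%N [:: 0; 1; d.+1]%N j).

(** Kronecker substitution: in degree [d] the exponents of the last two variables are digits in base
    [d.+1], so distinct monomials take distinct powers of [T] as values and cannot cancel. *)
Lemma kronecker_point_nonroot (k : fieldType) d (f : {mpoly k[3]}) :
  f \is d.-homog -> f != 0 ->
  (map_mpoly (@tofrac _ \o polyC) f).@[@kronecker_point k d] != 0.
Proof.
move=> /dhomogP hf f0.
pose e (m : 'X_{1..3}) := (m x1 + d.+1 * m x2)%N.
have -> : (map_mpoly (@tofrac _ \o polyC) f).@[@kronecker_point k d] =
    tofrac (\sum_(m <- msupp f) f@_m *: 'X^(e m)).
  rewrite {1}[f]mpolyE (raddf_sum (map_mpoly _)) (raddf_sum (meval _)) raddf_sum.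
  apply: eq_bigr => m _.
  rewrite /= map_mpolyZ map_mpolyX mevalZ mevalX -mul_polyC rmorphM /=.
  congr (_ * _); rewrite [LHS]big_ord_recl /= !big_ord_recl big_ord0.
  rewrite /kronecker_point /= expr0 rmorph1 expr1n mul1r mulr1 expr1.
  rewrite -!rmorphXn -rmorphM /= -exprM -exprD; congr (tofrac ('X^(_ + _ * _))).
  - by congr (m _); apply/val_inj.
  - by congr (m _); apply/val_inj.
rewrite tofrac_eq0.
have m0 := mlead_supp f0; set m := mlead f in m0.
apply/eqP => /(congr1 (fun q : {poly k} => q`_(e m))).
rewrite coef0 coef_sum (bigD1_seq m) ?msupp_uniq //= coefZ coefXn eqxx mulr1.
rewrite big_seq_cond big1 ?addr0 => [|m' /andP[m's ne]].
  by move/eqP; rewrite mcoeff_eq0 m0.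
rewrite coefZ coefXn; case: eqP => [em|]; last by rewrite mulr0.
case/eqP: ne; have := hf _ m's; have := hf _ m0.
rewrite /= !mdegE !sum_ord3 => dm dm'.
have e2 : m x2 = m' x2 by move: em; rewrite /e; nia.
have e1 : m x1 = m' x1 by move: em; rewrite /e; nia.
have e0 : m x0 = m' x0 by lia.
apply/mnmP => -[[|[|[|//]]] lti].
- by rewrite (_ : Ordinal lti = x0) //; apply/val_inj.
- by rewrite (_ : Ordinal lti = x1) //; apply/val_inj.
- by rewrite (_ : Ordinal lti = x2) //; apply/val_inj.
Qed.

Lemma exists_left_null (K : fieldType) m n (A : 'M[K]_(m, n)) :
  (n < m)%N -> exists2 v : 'rV_m, v != 0 & v *m A = 0.
Proof.
move=> ltnm; have: kermx A != 0.
  rewrite -mxrank_eq0 mxrank_ker subn_eq0 -ltnNge.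
  exact: leq_ltn_trans (rank_leq_col A) ltnm.
by case/rowV0Pn => v /sub_kermxP vA v0; exists v.
Qed.

(** Otherwise the products of [products_indep] would be dependent over [k(T)]. The second hypothesis
    represents each coefficient functional on [R_d] by a form; this version of nondegeneracy passes
    to [k(T)], since it can be checked on monomials. *)
Lemma dim_mul_linear_forms (k : fieldType) d (V : {vspace dhomog 3 k d.+1})
    (c : 'X_{1..3} -> k) (u := coeff_form (2 * d).+2 c) :
  (forall (f : dhomog 3 k d.+1) (h : dhomog 3 k d), f \in V ->
     u (val f * val h) = 0) ->
  (forall m, mdeg m = d -> exists f : dhomog 3 k d.+1,
     forall w : dhomog 3 k d, u (val w * val f) = (val w)@_m) ->
  (0 < \dim V)%N ->
  ((\dim V).*2 < \dim (mul_linear_forms V))%N.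
Proof.
move=> uV und dimV; set P := mul_linear_forms V; rewrite ltnNge.
apply/negP => leP.
pose K := {fraction {poly k}}.
pose iota : {rmorphism k -> K} := @tofrac {poly k} \o polyC.
pose G j : dhomog 3 k d.+1 := (vbasis V)`_j.
have GV (j : 'I_(\dim V)) : G j \in V by rewrite vbasis_mem // mem_nth ?size_tuple.
have frV : free (vbasis V) := basis_free (vbasisP V).
pose g (j : 'I_(\dim V)) := map_mpoly iota (val (G j)).
pose j0 := Ordinal dimV.
pose p := @kronecker_point k d.+1.
have G0 : val (G j0) != 0.
  have /(free_not0 frV) : G j0 \in vbasis V by rewrite mem_nth ?size_tuple.
  by apply: contraNneq => Gj0; apply/eqP/val_inj.
have homog_map e (f : {mpoly k[3]}) : f \is e.-homog -> map_mpoly iota f \is e.-homog.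
  move=> hf; apply/dhomogP => m; rewrite mcoeff_msupp mcoeff_map_mpoly => nz.
  by apply: (dhomog_mf hf); rewrite mcoeff_msupp; apply: contraNneq nz => ->; apply/eqP/(rmorph0 iota).
pose uK : {linear {mpoly K[3]} -> K | *%R} :=
  coeff_form (2 * d).+2 (fun m => iota (c m)).
have uKm (f1 f2 : {mpoly k[3]}) :
    uK (map_mpoly iota f1 * map_mpoly iota f2) = iota (u (f1 * f2)).
  by rewrite -rmorphM; apply: coeff_form_map.
have hX e m : mdeg m = e -> 'X_[m] \is [in k[3], e.-homog].
  by rewrite dhomogX /= => ->.
have c1 (w : {mpoly K[3]}) (f : {mpoly k[3]}) : w \is d.-homog -> f \is d.+1.-homog ->
    (forall m, mdeg m = d -> uK ('X_[m] * map_mpoly iota f) = 0) ->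
    uK (w * map_mpoly iota f) = 0.
  move=> /dhomogP hw hf h; rewrite [w]mpolyE mulr_suml linear_sum big_seq big1 //.
  by move=> m mw; rewrite -scalerAl linearZ_LR /= h ?mulr0 // hw.
pose B i j : 'rV[k]_(\dim P) := \row_l coord (vbasis P) l (mulX i (G j)).
have BE i (j : 'I_(\dim V)) : 'X_i * g j =
    \sum_l iota (B i j 0 l) *: map_mpoly iota (val (vbasis P)`_l).
  have := coord_vbasis (mulX_mem i (GV j)); move/(congr1 (map_mpoly iota \o val)).
  rewrite /= rmorphM /= map_mpolyX => ->; rewrite raddf_sum (raddf_sum (map_mpoly _)); apply: eq_bigr => l _.
  by rewrite mxE /= map_mpolyZ.
pose Cm i i' := \matrix_(j < \dim V)
  (map_mx iota (B i j) - p i' *: map_mx iota (B x0 j)).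
(* The rows are coordinates over [K] of the [2 \dim V + 1] products, with respect to the image of
   the basis of [P]; there are at most [2 \dim V] columns. *)
pose C := col_mx (col_mx (Cm x2 x2) (Cm x1 x1)) (map_mx iota (B x0 j0)).
have [|v v0 vC] := exists_left_null C; first by rewrite addnn addn1 ltnS.
pose al := lsubmx (lsubmx v); pose be := rsubmx (lsubmx v); pose ce := rsubmx v.
have vE : v = row_mx (row_mx al be) ce by rewrite /al /be !hsubmxK.
have relC l : \sum_j al 0 j * (iota (B x2 j 0 l) - p x2 * iota (B x0 j 0 l))
   + \sum_j be 0 j * (iota (B x1 j 0 l) - p x1 * iota (B x0 j 0 l))
   + ce 0 0 * iota (B x0 j0 0 l) = 0.
  move: vC; rewrite vE !mul_row_col => /matrixP/(_ 0 l).
  rewrite !mxE big_ord1 !mxE => vC; rewrite -[RHS]vC; congr (_ + _ + _).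
    by apply: eq_bigr => j _; rewrite !mxE.
  by apply: eq_bigr => j _; rewrite !mxE.
have gi i i' j : g j * ('X_i - p i' *: 'X_x0) =
    \sum_l (iota (B i j 0 l) - p i' * iota (B x0 j 0 l)) *:
      map_mpoly iota (val (vbasis P)`_l).
  rewrite mulrBr -scalerAr ![g j * _]mulrC !BE scaler_sumr -sumrB.
  by apply: eq_bigr => l _; rewrite scalerBl scalerA.
have rel : (\sum_j al 0 j *: g j) * ('X_x2 - p x2 *: 'X_x0)
    + (\sum_j be 0 j *: g j) * ('X_x1 - p x1 *: 'X_x0)
    + ce 0 0 *: ('X_x0 * g j0) = 0.
  have sg (a : 'rV_(\dim V)) i : (\sum_j a 0 j *: g j) * ('X_i - p i *: 'X_x0) =
      \sum_l (\sum_j a 0 j * (iota (B i j 0 l) - p i * iota (B x0 j 0 l))) *: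
        map_mpoly iota (val (vbasis P)`_l).
    rewrite mulr_suml; under eq_bigr => j _ do
      rewrite -scalerAl gi scaler_sumr.
    rewrite exchange_big; apply: eq_bigr => l _; rewrite scaler_suml.
    by apply: eq_bigr => j _; rewrite scalerA.
  rewrite !sg BE scaler_sumr -!big_split big1 // => l _.
  by rewrite /= scalerA -!scalerDl relC scale0r.
have [||||||//|al0 be0 ce0] :=
  @products_indep K d _ g uK p j0 (al 0) (be 0) (ce 0 0).
- by move=> j; apply: homog_map; exact: valP.
- move=> j h hh; rewrite mulrC; apply: (c1 _ _ hh (valP _)) => m dm.
  rewrite mulrC -(map_mpolyX iota) uKm.
  by rewrite (uV _ (DHomog (hX _ _ dm))) ?rmorph0.
- move=> w hw w0; apply/mpolyP => m; rewrite mcoeff0.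
  have [dm|dm] := eqVneq (mdeg m) d; last exact: dhomog_nemf_coeff hw dm.
  (* Each coefficient of [w] is a value [uK (w * f)] with [f] defined over [k], hence zero. *)
  have [f uf] := und _ dm; rewrite -(w0 _ (homog_map _ _ (valP f))).
  rewrite {1 2}[w]mpolyE raddf_sum mulr_suml linear_sum !big_seq.
  apply: eq_bigr => m' /(dhomog_mf hw) dm'.
  rewrite /= mcoeffZ mcoeffX -scalerAl linearZ_LR /= -(map_mpolyX iota) uKm.
  rewrite (uf (DHomog (hX _ _ dm'))) /= mcoeffX.
  by case: eqP => _; rewrite ?rmorph1 ?rmorph0.
- move=> e e0 j.
  (* The coordinate functionals of the basis of [V] extend to [K] and separate the [g j]. *)
  have lj : linear_for *%R (coord (vbasis V) j) by move=> a f h; rewrite linearP.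
  have [cj cjE] := @coeff_form_rep _ _ _ _ _ lj (ltnSn d.+1).
  have cg i : coeff_form d.+2 (fun m => iota (cj m)) (g i) = iota (i == j)%:R.
    by rewrite [LHS](coeff_form_map iota) cjE; congr (iota _); apply: coord_free.
  have := congr1 (coeff_form d.+2 (fun m => iota (cj m))) e0.
  rewrite linear_sum linear0 (bigD1 j) //= big1 ?addr0 => [|i ij].
    by rewrite linearZ_LR [in LHS]/= cg eqxx (rmorph1 iota) mulr1.
  by rewrite linearZ_LR [in LHS]/= cg (negPf ij) (rmorph0 iota) mulr0.
- by rewrite /p /kronecker_point /= expr0 rmorph1.
- exact: kronecker_point_nonroot (valP (G j0)) G0.
case/eqP: v0; rewrite vE.
have -> : al = 0 by apply/rowP => j; rewrite al0 mxE.
have -> : be = 0 by apply/rowP => j; rewrite be0 mxE.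
have -> : ce = 0 by apply/rowP => j; rewrite ord1 ce0 mxE.
by rewrite !row_mx0.
Qed.

Lemma mpoly_const0 (R : comNzRingType) n (f : {mpoly R[n]}) :
  f@_0%MM = 0 -> exists h : 'I_n -> {mpoly R[n]}, f = \sum_i 'X_i * h i.
Proof.
move=> f0; have [h fE] := mpoly_comp_congr [tuple 0 | i < n] f.
exists h; rewrite {1}fE.
have -> : f \mPo [tuple 0 | i < n] = (f@_0%MM)%:MP_[n].
  rewrite comp_mpolyEX [in RHS](mpolyE f) (raddf_sum (mcoeff _)) raddf_sum; apply: eq_bigr => m _ /=.
  rewrite mcoeffZ mcoeffX comp_mpolyX.
  under eq_bigr => i _ do rewrite tnth_mktuple.
  rewrite prodrXr -mdegE expr0n mdeg_eq0 mpolyCM mul_mpolyC.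
  by case: eqP => _; rewrite ?mpolyC1 ?mpolyC0.
rewrite f0 mpolyC0 add0r; apply: eq_bigr => i _.
by rewrite tnth_mktuple subr0.
Qed.

(** * Graded pieces and socle of the quotient *)

(** As [S] is not assumed to contain [0], uniqueness is applied to [e i]: adding [v] to its
    coordinates yields a second expansion. *)
Lemma kbasis_free (k : fieldType) (V : lmodType k) (S : V -> Prop) m
    (e : 'I_m -> V) (v : 'rV[k]_m) :
  kbasis S e -> \sum_i v 0 i *: e i = 0 -> v = 0.
Proof.
case=> Se Be ve0; apply/rowP => i; rewrite mxE.
have [c [_ uc]] := Be _ (Se i).
have ei : e i = \sum_j (delta_mx 0 i : 'rV[k]_m) 0 j *: e j.
  rewrite (bigD1 i) //= !mxE !eqxx scale1r big1 ?addr0 // => j /negPf ji.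
  by rewrite mxE ji andbF scale0r.
have := uc (delta_mx 0 i + v); rewrite (uc _ ei) => /(_ _)/rowP.
have : e i = \sum_j (delta_mx 0 i + v) 0 j *: e j.
  transitivity (e i + \sum_i v 0 i *: e i); first by rewrite ve0 addr0.
  rewrite {1}ei -big_split; apply: eq_bigr => j _.
  by rewrite [in RHS]mxE scalerDl.
move=> h /(_ h i); rewrite [in RHS]mxE => /eqP.
by rewrite -subr_eq0 opprD addrA subrr add0r oppr_eq0 => /eqP.
Qed.

Lemma kdim_leq (k : fieldType) (V : lmodType k) (S : V -> Prop) m n :
  kdim S m -> kdim S n -> (m <= n)%N.
Proof.
case=> e [Se Be] [f [Sf Bf]]; rewrite leqNgt; apply/negP => ltnm.
have /fin_all_exists[c ce] i : exists c : 'rV[k]_n, e i = \sum_j c 0 j *: f j.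
  by case: (Bf _ (Se i)) => c [ce _]; exists c.
have [v v0 vc] := exists_left_null (\matrix_i c i) ltnm.
case/eqP: v0; apply: (kbasis_free (conj Se Be)).
under eq_bigr => i _ do rewrite ce scaler_sumr.
rewrite exchange_big big1 // => j _ /=.
under eq_bigr => i _ do rewrite scalerA.
rewrite -scaler_suml -[RHS](scale0r (f j)); congr (_ *: _).
move/matrixP: vc => /(_ 0 j); rewrite !mxE => vc; rewrite -[RHS]vc.
by apply: eq_bigr => i _; rewrite mxE.
Qed.

(** [compressed] asserts only the existence of a socle function; uniqueness of dimension identifies
    it with the one from [socle_shifts]. *)
Lemma kdim_inj (k : fieldType) (V : lmodType k) (S : V -> Prop) m n :
  kdim S m -> kdim S n -> m = n.
Proof. by move=> Sm Sn; apply/eqP; rewrite eqn_leq !(kdim_leq (S := S)). Qed.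

Lemma kdim0 (k : fieldType) (V : lmodType k) (S : V -> Prop) :
  (forall v, S v -> v = 0) -> kdim S 0.
Proof.
move=> S0; exists (fun=> 0); split=> [[] //|v /S0 ->].
by exists 0; split=> [|c _]; [rewrite big_ord0 | apply/rowP => -[]].
Qed.

Lemma kdim1 (k : fieldType) (V : lmodType k) (S : V -> Prop) v0 :
  S v0 -> v0 != 0 -> (forall v, S v -> exists a, v = a *: v0) -> kdim S 1.
Proof.
move=> Sv0 v0n Sv; exists (fun=> v0); split=> // v /Sv[a ->].
exists a%:M; split=> [|c]; first by rewrite big_ord1 mxE eqxx.
rewrite big_ord1 => /eqP; rewrite -subr_eq0 -scalerBl scaler_eq0 (negPf v0n) orbF.
rewrite subr_eq0 => /eqP->; apply/rowP => i; rewrite !ord1 mxE eqxx.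
by rewrite mulr1n.
Qed.

Section Quotient.
Context (k : fieldType) (n : nat) (I : idealr {mpoly k[n]}).

Lemma pi_eq0 f : (\pi_{ideal_quot I} f == 0) = (f \in I).
Proof.
by rewrite -(rmorph0 (\pi_{ideal_quot I})) -Quotient.idealrBE subr0.
Qed.

Lemma pi_scale c f : \pi_{ideal_quot I} (c *: f) = c *: \pi_{ideal_quot I} f.
Proof. by rewrite -mul_mpolyC rmorphM. Qed.

Lemma socle_piP f :
  socle I (\pi_{ideal_quot I} f) <-> forall i, 'X_i * f \in I.
Proof.
split=> [sf i|Xf h /mpoly_const0[q ->]].
  rewrite -pi_eq0 rmorphM; apply/eqP/sf; rewrite mcoeffX.
  by case: eqP => // /(congr1 mdeg) /eqP; rewrite mdeg1 mdeg0.
rewrite -rmorphM; apply/eqP; rewrite pi_eq0 mulr_suml.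
by apply: rpred_sum => i _; rewrite mulrAC mulrC idealMr.
Qed.

End Quotient.

(** Coordinates chosen on a basis of forms turn a component of the quotient into a linear map
    between finite-dimensional spaces, where dimensions can be counted. *)
Lemma quot_deg_hom (k : fieldType) n d m (I : idealr {mpoly k[n.+1]}) :
  kdim (quot_deg I d) m ->
  exists L : 'Hom(dhomog n.+1 k d, 'rV[k]_m),
    (forall f, (L f == 0) = (val f \in I)) /\ limg L = fullv.
Proof.
case=> e Be; have [Se Bv] := Be.
set b := vbasis {:dhomog n.+1 k d}.
have /fin_all_exists[c cE] (i : 'I_(\dim {:dhomog n.+1 k d})) :
    exists c : 'rV[k]_m, \pi_{ideal_quot I} (val b`_i) = \sum_j c 0 j *: e j.
  have [|c [cE _]] := Bv (\pi_{ideal_quot I} (val b`_i)); last by exists c.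
  by exists (val b`_i) => //; apply: valP.
pose l f := \sum_i coord b i f *: c i.
have ll : linear l.
  move=> a f g; rewrite /l scaler_sumr -big_split; apply: eq_bigr => i _.
  by rewrite linearP scalerDl scalerA.
pose lm := GRing.isLinear.Build _ _ _ _ l ll.
pose lL : {linear dhomog n.+1 k d -> 'rV[k]_m} := HB.pack l lm.
have LE f : \pi_{ideal_quot I} (val f) = \sum_j (linfun lL f) 0 j *: e j.
  rewrite lfunE [lL f]/(l f) {1}(coord_vbasis (memvf f)) raddf_sum raddf_sum /=.
  under eq_bigr => i _ do rewrite /= pi_scale cE scaler_sumr.
  rewrite exchange_big; apply: eq_bigr => j _ /=; rewrite /l summxE.
  by rewrite scaler_suml; apply: eq_bigr => i _; rewrite mxE scalerA.
exists (linfun lL); split=> [f|].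
  rewrite -pi_eq0 LE; apply/eqP/eqP => [->|/(kbasis_free Be) //].
  by rewrite big1 // => j _; rewrite mxE scale0r.
apply/eqP; rewrite eqEsubv subvf; apply/subvP => r _.
have /fin_all_exists2[f fd ef] j :
    exists2 f : {mpoly k[n.+1]}, f \is d.-homog & e j = \pi_{ideal_quot I} f.
  exact: Se.
pose F := \sum_j r 0 j *: DHomog (fd j).
suff -> : r = linfun lL F by rewrite memv_img ?memvf.
apply/eqP; rewrite -subr_eq0; apply/eqP/(kbasis_free Be).
have eF : \pi_{ideal_quot I} (val F) = \sum_j r 0 j *: e j.
  rewrite raddf_sum raddf_sum; apply: eq_bigr => j _.
  by rewrite /= pi_scale -ef.
transitivity (\sum_j (r 0 j *: e j - (linfun lL F) 0 j *: e j)).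
  by apply: eq_bigr => j _; rewrite 2!mxE scalerBl.
by rewrite sumrB -LE eF subrr.
Qed.

Lemma dim_lker_surj (k : fieldType) (U : vectType k) m (L : 'Hom(U, 'rV[k]_m)) :
  limg L = fullv -> (\dim (lker L) + m = \dim {:U})%N.
Proof.
move=> sL; rewrite -(limg_ker_dim L fullv) capfv sL; congr (_ + _)%N.
by rewrite dimvf /dim /= mul1n.
Qed.

(** Every socle element is a combination of two homogeneous generators. As [I] is homogeneous,
    taking the component of degree [d] removes the generators of other degrees. *)
Lemma socle_shifts2 (k : fieldType) n (I : idealr {mpoly k[n]}) s t :
  homogeneous_ideal I -> socle_shifts I [tuple s; t] -> (s < t)%N ->
  exists f0 : dhomog n k s,
  [/\ forall d (f : {mpoly k[n]}), d != s -> d != t -> f \is d.-homog ->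
        (forall i, 'X_i * f \in I) -> f \in I,
      forall f : {mpoly k[n]}, f \is s.-homog -> (forall i, 'X_i * f \in I) ->
        exists a, f - a *: val f0 \in I
    & [/\ kdim (socle_deg I s) 1, kdim (socle_deg I t) 1
        & forall d, d != s -> d != t -> kdim (socle_deg I d) 0]].
Proof.
move=> Ihom [e [Be de]] st.
have [Se Bv] := Be.
have [f0 f0s e0] := de ord0; have [f1 f1t e1] := de ord_max.
rewrite (tnth_nth 0%N) /= in f0s; rewrite (tnth_nth 0%N) /= in f1t.
have en i : e i != 0.
  apply/eqP => ei; have /rowP/(_ i)/eqP : (delta_mx 0 i : 'rV[k]_2) = 0.
    apply: (kbasis_free Be); rewrite (bigD1 i) //= ei scaler0 add0r big1 // => j.
    by move=> /negPf ji; rewrite mxE ji andbF scale0r.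
  by rewrite !mxE !eqxx oner_eq0.
have span (f : {mpoly k[n]}) : (forall i, 'X_i * f \in I) ->
    exists a b, f - a *: f0 - b *: f1 \in I.
  move=> /socle_piP/Bv[c [fc _]]; exists (c 0 ord0), (c 0 ord_max).
  rewrite -pi_eq0 !rmorphB /= !pi_scale -e0 -e1 fc big_ord_recl big_ord1.
  rewrite (_ : lift ord0 ord0 = ord_max); last exact/val_inj.
  by rewrite -[_ - _ - _]addrA -opprD subrr.
have proj d (f : {mpoly k[n]}) : f \is d.-homog -> (forall i, 'X_i * f \in I) ->
    exists a b, f - a *: pihomog mdeg d f0 - b *: pihomog mdeg d f1 \in I.
  move=> fd /span[a [b /Ihom/(_ d)]].
  rewrite !pihomogB !(linearZ_LR (pihomog mdeg d)) /= (pihomog_dE fd) => h.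
  by exists a, b.
have f1s : pihomog mdeg s f1 = 0 by rewrite (pihomog_ne0 _ f1t) // gtn_eqF.
have f0t : pihomog mdeg t f0 = 0 by rewrite (pihomog_ne0 _ f0s) // ltn_eqF.
have P0 d (f : {mpoly k[n]}) : d != s -> d != t -> f \is d.-homog ->
    (forall i, 'X_i * f \in I) -> f \in I.
  move=> ds dt fd /(proj d f fd)[a [b]].
  rewrite (pihomog_ne0 _ f0s) 1?eq_sym // (pihomog_ne0 _ f1t) 1?eq_sym //.
  by rewrite !scaler0 !subr0.
have Ps (f : {mpoly k[n]}) : f \is s.-homog -> (forall i, 'X_i * f \in I) ->
    exists a, f - a *: f0 \in I.
  move=> fd /(proj s f fd)[a [b]].
  by rewrite f1s scaler0 subr0 (pihomog_dE f0s); exists a.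
have Pt (f : {mpoly k[n]}) : f \is t.-homog -> (forall i, 'X_i * f \in I) ->
    exists a, f - a *: f1 \in I.
  move=> fd /(proj t f fd)[a [b]].
  by rewrite f0t scaler0 subr0 (pihomog_dE f1t); exists b.
exists (DHomog f0s); split=> //; split.
- have Ss : socle_deg I s (e ord0) by split; [apply: Se | exists f0].
  apply: (kdim1 Ss (en _)).
  move=> v [] /[swap] -[f fs ->] sf.
  have [a fa] := Ps f fs (iffLR (socle_piP I f) sf); exists a.
  by apply/eqP; rewrite -subr_eq0 e0 -pi_scale -rmorphB pi_eq0.
- have St : socle_deg I t (e ord_max) by split; [apply: Se | exists f1].
  apply: (kdim1 St (en _)).
  move=> v [] /[swap] -[f fs ->] sf.
  have [a fa] := Pt f fs (iffLR (socle_piP I f) sf); exists a.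
  by apply/eqP; rewrite -subr_eq0 e1 -pi_scale -rmorphB pi_eq0.
- move=> d ds dt; apply: kdim0 => v [] /[swap] -[f fd ->] sf.
  by apply/eqP; rewrite pi_eq0; apply: P0 fd _ => //; apply/socle_piP.
Qed.

(** The socle function is forced to be [1] at [s] and [t] and [0] elsewhere, so the top degree is
    [t] and only two summands survive. *)
Lemma compressed2 (k : fieldType) (I : idealr {mpoly k[3]}) s t :
  (s < t)%N -> compressed I ->
  kdim (socle_deg I s) 1 -> kdim (socle_deg I t) 1 ->
  (forall d, d != s -> d != t -> kdim (socle_deg I d) 0) ->
  forall i, (i <= t)%N -> kdim (quot_deg I i)
    (minn 'C(2 + i, i) ((i <= s) * 'C(2 + (s - i), s - i)
                        + 'C(2 + (t - i), t - i)))%N.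
Proof.
move=> st [c [t' [kc ct c0 H]]] ks kt k0.
have cs : c s = 1%N := kdim_inj (kc s) ks.
have ct1 : c t = 1%N := kdim_inj (kc t) kt.
have cd d : d != s -> d != t -> c d = 0%N by move=> ds dt; apply: kdim_inj (k0 d ds dt).
have tt : t' = t.
  case: (ltngtP t' t) => // [/c0|lt]; first by rewrite ct1.
  by case: ct; apply: cd; apply/eqP => e; rewrite e ?ltnn // in lt; lia.
rewrite {}tt in H => i it; have := H i it.
suff -> : (\sum_(0 <= l < t.+1 | i <= l) c l * 'C(2 + (l - i), l - i) =
    (i <= s) * 'C(2 + (s - i), s - i) + 'C(2 + (t - i), t - i))%N by [].
rewrite big_mkcond (bigD1_seq t) ?mem_index_iota ?iota_uniq //= it ct1 mul1n addnC.
congr (_ + _)%N; rewrite big_mkcond (bigD1_seq s) ?mem_index_iota ?iota_uniq //=.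
  rewrite (ltn_eqF st) cs big1 ?addn0; first by case: leqP; rewrite ?mul1n.
  move=> l ls; case: (eqVneq l t) => //= lt; rewrite cd ?mul0n //.
  by case: ifP.
by rewrite ltnS ltnW.
Qed.

(** A division-free form that [lia] can use. *)
Lemma double_bin2 n : ('C(2 + n, n) * 2 = n.+2 * n.+1)%N.
Proof.
have := @bin_sub n.+2 2 isT; rewrite !subSS subn0 => ->.
by rewrite bin2 muln2 -[RHS]odd_double_half oddM /= negbK andbN.
Qed.

Lemma dim_dhomog3 (k : fieldType) d : \dim {:dhomog 3 k d} = 'C(2 + d, d).
Proof. by rewrite dimvf addnC. Qed.

Lemma dim_ideal_piece (k : fieldType) (I : idealr {mpoly k[3]}) d m :
  kdim (quot_deg I d) m ->
  exists2 V : {vspace dhomog 3 k d},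
    forall f, (f \in V) = (val f \in I) & (\dim V + m = 'C(2 + d, d))%N.
Proof.
move=> /quot_deg_hom[L [LE sL]]; exists (lker L).
  by move=> f; rewrite memv_ker LE.
by rewrite dim_lker_surj // dim_dhomog3.
Qed.

(** * Growth of the ideal from degree [s] to [s + 1], with [s = d.+1] *)

Section Growth.
Context (k : fieldType) (I : idealr {mpoly k[3]}) (d : nat).
Context (d_ge2 : (2 <= d)%N) (Ihom : homogeneous_ideal I).
Context (Icompressed : compressed I).
Context (Isocle : socle_shifts I [tuple d.+1; (2 * d).+1]).

(** Induction on the complementary degree [j]: each ['X_i * f] satisfies the hypothesis with [j]
    lowered, hence lies in [I], and there is no socle strictly between degrees [d.+1] and
    [(2 * d).+1]. For [j = 0] take [h = 1]. *)
Lemma annihilator_top (e j : nat) (f : {mpoly k[3]}) :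
  (d.+1 < e)%N -> (e + j = (2 * d).+1)%N -> f \is e.-homog ->
  (forall h, h \is j.-homog -> f * h \in I) -> f \in I.
Proof.
have lt : (d.+1 < (2 * d).+1)%N by lia.
have [f0 [S0 _ _]] := socle_shifts2 Ihom Isocle lt.
elim: j e f => [|j IH] e f de ej fe fI.
  by rewrite -[f]mulr1; apply/fI/dhomog1.
apply: (S0 e) => // [||i]; [by rewrite gtn_eqF | by rewrite ltn_eqF //; lia |].
apply: (IH e.+1); [by lia | by lia | exact: (mulX_homog i (DHomog fe)) |].
move=> h hj; rewrite -mulrA mulrCA; apply: fI.
exact: (mulX_homog i (DHomog hj)).
Qed.

Lemma ideal_growth :
  exists V : {vspace dhomog 3 k d.+1}, exists W : {vspace dhomog 3 k d.+2},
  [/\ forall f, (f \in V) = (val f \in I), forall f, (f \in W) = (val f \in I)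
    & (\dim W <= \dim (mul_linear_forms V) + d.+3)%N].
Proof.
have lt : (d.+1 < (2 * d).+1)%N by lia.
have [f0 [_ Ss [ks kt k0]]] := socle_shifts2 Ihom Isocle lt.
have H := compressed2 lt Icompressed ks kt k0.
have b0 := double_bin2 d.
have b1 := double_bin2 d.+1; have b2 := double_bin2 d.+2.
have [V VI dimV] := dim_ideal_piece (H _ (ltnW lt)).
have [W WI dimW] := dim_ideal_piece (H d.+2 ltac:(lia)).
have kd1 : kdim (quot_deg I (2 * d).+1) 1.
  have := H _ (leqnn _); rewrite leqNgt lt mul0n add0n subnn bin0.
  by rewrite (minn_idPr _) // bin_gt0 leq_addl.
have [L [LE sL]] := quot_deg_hom kd1.
have b3 := double_bin2 d.-1.
have {dimV} dimV : \dim V = d.+1.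
  move: dimV; rewrite leqnn subnn mul1n (_ : _ - _ = d)%N; last by lia.
  by rewrite bin0; lia.
have {dimW} dimW : \dim W = (3 * d.+2)%N.
  move: dimW; rewrite ltnn mul0n add0n (_ : _ - _ = d.-1)%N; last by lia.
  by move: b2 b3; rewrite (ltn_predK d_ge2); lia.
exists V, W; split=> //.
(* The difference [3 (d + 2) - (d + 3)] is [2 (d + 1) + 1]. *)
suff: (2 * d.+1 < \dim (mul_linear_forms V))%N by rewrite dimW; lia.
have lL : linear_for *%R (fun f => L f 0 0).
  by move=> a f g; rewrite linearP !mxE.
have [c cE] := coeff_form_rep lL (ltnSn (2 * d).+1).
pose u : {linear {mpoly k[3]} -> k | *%R} := coeff_form (2 * d).+2 c.
have uI (f : {mpoly k[3]}) : f \is (2 * d).+1.-homog -> (u f == 0) = (f \in I).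
  move=> fd; rewrite -[f \in I](LE (DHomog fd)) [u f](cE (DHomog fd)).
  apply/eqP/eqP => [L0|->]; last by rewrite mxE.
  by apply/rowP => i; rewrite !ord1 L0 mxE.
have hM (f : dhomog 3 k d.+1) (h : dhomog 3 k d) :
    val h * val f \is (2 * d).+1.-homog.
  rewrite (_ : (2 * d).+1 = d + d.+1)%N; last lia.
  exact: dhomogM (valP h) (valP f).
suff: ((\dim V).*2 < \dim (mul_linear_forms V))%N by rewrite {1}dimV -mul2n.
apply: (@dim_mul_linear_forms _ _ _ c); last by rewrite dimV.
  move=> f h fV; apply/eqP; rewrite mulrC (uI _ (hM f h)) idealMr //.
  by rewrite -VI.
set N := \dim {:dhomog 3 k d}; pose b := vbasis {:dhomog 3 k d}.
(* [psi f] is the functional sending [w] in [R_d] to [u (w f)], written in the basis dual to [b]. *)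
pose psi (f : dhomog 3 k d.+1) := \row_(i < N) u (val b`_i * val f).
have psil : linear psi.
  move=> a f g; apply/rowP => i; rewrite !mxE /= mulrDr -scalerAr linearP.
  by [].
pose psiM := GRing.isLinear.Build _ _ _ _ psi psil.
pose psiL : {linear dhomog 3 k d.+1 -> 'rV[k]_N} := HB.pack psi psiM.
pose Psi := linfun psiL.
have uw (f : dhomog 3 k d.+1) (w : dhomog 3 k d) :
    u (val w * val f) = \sum_i coord b i w * (Psi f) 0 i.
  rewrite {1}(coord_vbasis (memvf w)) raddf_sum mulr_suml linear_sum.
  by apply: eq_bigr => i _; rewrite /= -scalerAl linearZ_LR lfunE /= mxE.
(* If [f] pairs to zero with [R_d], then [annihilator_top] puts each ['X_i * f] in [I], so [f] is a
   socle class of degree [d.+1]. *)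
have kerPsi : (lker Psi <= V + <[f0]>)%VS.
  apply/subvP => f; rewrite memv_ker => /eqP f0E.
  have [|a fa] := Ss (val f) (valP f).
    move=> i; apply: (@annihilator_top d.+2 d.-1); rewrite ?mulX_homog //; first lia.
    move=> h hd; rewrite -mulrA mulrCA mulrC.
    have Xh : 'X_i * h \is d.-homog.
      by have := mulX_homog i (DHomog hd); rewrite (ltn_predK d_ge2).
    rewrite -uI; last exact: (hM f (DHomog Xh)).
    rewrite [X in X == 0](uw f (DHomog Xh)) f0E big1 // => l _.
    by rewrite mxE mulr0.
  rewrite -[f](subrK (a *: f0)); apply: memv_add; last exact: memvZ (memv_line _).
  by rewrite VI.
(* The kernel has dimension at most [d + 2], which is [dim R_{d+1} - dim R_d]. *)
have sPsi : limg Psi = fullv.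
  apply/eqP; rewrite eqEdim subvf dimvf /dim /= mul1n.
  have := limg_ker_dim Psi fullv; rewrite capfv dim_dhomog3.
  have dN : N = 'C(2 + d, d) := dim_dhomog3 k d.
  have := leq_trans (dimvS kerPsi) (dimv_add_leqif _ _).
  have := dim_vline f0; case: (f0 != 0) => ->; rewrite dimV; lia.
move=> m _; pose r := \row_(i < N) (val b`_i)@_m.
have /memv_imgP[f _ rE] : r \in limg Psi by rewrite sPsi memvf.
exists f => w; rewrite [LHS](uw f w) -rE {2}(coord_vbasis (memvf w)).
rewrite raddf_sum (raddf_sum (mcoeff m)); apply: eq_bigr => i _.
by rewrite /= mcoeffZ mxE.
Qed.

End Growth.

(** * The first Tor module *)

(** In coordinates [psi] becomes a matrix [X] with [\dim W] columns on [C]; rank-nullity applies,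
    and the part of [C] killed by [X] lies in [B]. *)
Lemma mxrank_sub_dim (k : fieldType) (U : vectType k) n m1 m2
    (C : 'M[k]_(m1, n)) (B : 'M[k]_(m2, n)) (W : {vspace U})
    (psi : {linear 'rV[k]_n -> U}) :
  (forall c, (c <= C)%MS -> psi c \in W) ->
  (forall c, (c <= C)%MS -> psi c = 0 -> (c <= B)%MS) ->
  (\rank C - \rank B <= \dim W)%N.
Proof.
move=> CW CB.
pose x (c : 'rV[k]_n) := \row_(i < \dim W) coord (vbasis W) i (psi c).
have xl : linear x.
  by move=> a c c'; apply/rowP => i; rewrite !mxE !linearP.
pose xm := GRing.isLinear.Build _ _ _ _ x xl.
pose xL : {linear 'rV[k]_n -> 'rV[k]_(\dim W)} := HB.pack x xm.
pose X := lin1_mx xL.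
have XE c : c *m X = x c by rewrite mul_rV_lin1.
rewrite leq_subLR -(mxrank_mul_ker C X) addnC leq_add ?rank_leq_col //.
apply/mxrankS/row_subP => i; move: (row_sub i (C :&: kermx X)%MS).
rewrite sub_capmx => /andP[cC /sub_kermxP]; rewrite XE => xc.
apply: CB => //; rewrite (coord_vbasis (CW _ cC)) big1 // => j _.
by move/rowP: xc => /(_ j); rewrite !mxE => ->; rewrite scale0r.
Qed.

Lemma homogz_homog (k : fieldType) n (d : nat) (f : {mpoly k[n]}) :
  homogz d%:Z f -> f \is d.-homog.
Proof. by move=> fd; apply/dhomogP => m /fd[]. Qed.

Lemma homogz_sum (k : fieldType) n (d : int) (A : Type) (r : seq A)
    (F : A -> {mpoly k[n]}) :
  (forall a, homogz d (F a)) -> homogz d (\sum_(a <- r) F a).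
Proof.
move=> Fd m; elim/big_ind: _ => [|f g fd gd|a _]; last exact: Fd.
  by rewrite msupp0.
by move=> /msuppD_le; rewrite mem_cat => /orP[].
Qed.

Lemma homogzM (k : fieldType) n (d e : int) (f g : {mpoly k[n]}) :
  homogz d f -> homogz e g -> homogz (d + e) (f * g).
Proof.
move=> fd ge m /msuppM_le /allpairsP[[m1 m2] [/fd <- /ge <- ->]].
by rewrite mdegD.
Qed.

(** A nonzero constant term in the differential joins generators of equal degree, so the reduced
    differential respects the grading. *)
Lemma tor_part_diff (k : fieldType) n (I : idealr {mpoly k[n]})
    (F : graded_free_resolution I) i j :
  tor_part F i.+1 j *m tor_diff F i = tor_diff F i *m tor_part F i j.
Proof.
apply/matrixP => a b; rewrite mul_diag_mx mul_mx_diag !mxE.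
have [/gdiff_homog/esym/eqP|D0] := boolP (0%MM \in msupp (gdiff F i a b)).
  by rewrite mdeg0 subr_eq0 => /eqP ->; apply: mulrC.
by rewrite memN_msupp_eq0 // mulr0 mul0r.
Qed.

Lemma tor_partP (k : fieldType) n (I : idealr {mpoly k[n]})
    (F : graded_free_resolution I) i j (c : 'rV[k]_(grank F i)) :
  (c <= tor_part F i j)%MS -> c *m tor_part F i j = c.
Proof.
case/submxP => y ->; rewrite -mulmxA; congr (_ *m _); apply/matrixP => a b.
by rewrite mul_diag_mx !mxE mulrnAr -natrM mulnb andbb.
Qed.

Section Tor1.
Context (k : fieldType) (n : nat) (I : idealr {mpoly k[n.+1]}) (d : nat).
Context (F : graded_free_resolution I).
Context (V : {vspace dhomog n.+1 k d}) (W : {vspace dhomog n.+1 k d.+1}).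
Context (Ihom : homogeneous_ideal I).
Context (VI : forall f, (f \in V) = (val f \in I)).
Context (WI : forall f, (f \in W) = (val f \in I)).
Local Notation P := (mul_linear_forms V).

(* Lifting the augmentation to [sigma : F_0 -> R], [e_b |-> f b], sends the
   syzygies into [I]. With [aug u = 1], any [v] in [F_0] is
   [\sum_b v_b (e_b - f b u) + (sigma v) u], so a syzygy [v] with entries in
   the maximal ideal [m] and with [sigma v] in [m I] lies in [m] times the
   syzygies. *)
Lemma tor1_dim_leq : (tor_dim F 1 d.+1%:Z <= \dim W - \dim P)%N.
Proof.
pose aug (v : 'rV[{mpoly k[n.+1]}]_(grank F 0)) :=
  \sum_b \pi_{ideal_quot I} (v 0 b) * gaug b.
have /fin_all_exists2[f fd fE] (b : 'I_(grank F 0)) :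
    exists2 f, homogz (gdeg b) f & gaug b = \pi_{ideal_quot I} f.
  exact: gaug_homog.
have [u uE] := gaug_surj F 1.
pose sigma (v : 'rV[{mpoly k[n.+1]}]_(grank F 0)) := \sum_b v 0 b * f b.
have augE v : aug v = \pi_{ideal_quot I} (sigma v).
  by rewrite raddf_sum; apply: eq_bigr => b _; rewrite /= fE rmorphM.
pose D0 := gdiff F 0; pose D1 := gdiff F 1.
have sD a : sigma (row a D0) \in I.
  rewrite -pi_eq0 -augE; apply/eqP/(gexact0 (g := F)).
  by exists (delta_mx 0 a); rewrite rowE.
pose h a := DHomog (pihomogP mdeg d.+1 (sigma (row a D0))).
pose Phi (c : 'rV[k]_(grank F 1)) := \sum_a c 0 a *: h a.
have PhiW c : Phi c \in W.
  apply: rpred_sum => a _; apply: rpredZ; rewrite WI /=; exact: Ihom.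
have PW : (P <= W)%VS.
  apply/subvP => g /mul_linear_formsP[q qV gE]; rewrite WI gE.
  by apply: rpred_sum => i _; rewrite idealMr // -VI.
(* [Q] has kernel [P], so [Q @: W] is a model of the quotient [W / P]. *)
pose Q := (\1 - projv P)%VF.
have QE g : Q g = g - projv P g by rewrite add_lfunE opp_lfunE id_lfunE.
have kerQ : lker Q = P.
  apply/vspaceP => g; rewrite memv_ker QE subr_eq0.
  by apply/eqP/idP => [->|/projv_id ->//]; apply: memv_proj.
have <- : \dim (Q @: W) = (\dim W - \dim P)%N.
  by rewrite -(limg_ker_dim Q W) kerQ (capv_idPr PW) addKn.
pose psi (c : 'rV[k]_(grank F 1)) := Q (Phi c).
have psil : linear psi.
  move=> a c c'; rewrite /psi -linearP; congr (Q _).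
  rewrite /Phi scaler_sumr -big_split; apply: eq_bigr => b _.
  by rewrite !mxE scalerDl scalerA.
pose psiM := GRing.isLinear.Build _ _ _ _ psi psil.
pose psiL : {linear 'rV[k]_(grank F 1) -> dhomog n.+1 k d.+1} := HB.pack psi psiM.
apply: (@mxrank_sub_dim _ _ _ _ _ _ _ _ psiL) => c.
  by move=> _; apply: memv_img.
rewrite sub_capmx => /andP[/tor_partP cT /sub_kermxP cD] /eqP.
rewrite -[_ == 0]memv_ker kerQ => /mul_linear_formsP[q qV PhiE].
pose v := map_mx (@mpolyC n.+1 k) c *m D0.
have sv : sigma v = \sum_i 'X_i * val (q i).
  rewrite -PhiE raddf_sum /sigma.
  under eq_bigr => b _ do rewrite mxE mulr_suml.
  rewrite exchange_big; apply: eq_bigr => a _ /=.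
  (* The truncation in [h] loses nothing: [c] is supported on generators of degree [d.+1], whose
     images are already homogeneous. *)
  have -> : c 0 a *: pihomog mdeg d.+1 (sigma (row a D0)) =
      c 0 a *: sigma (row a D0).
    have [ja|/negPf jNa] := eqVneq (gdeg a) d.+1%:Z; last first.
      by rewrite -cT mul_mx_diag !mxE jNa mulr0 !scale0r.
    rewrite pihomog_dE //; apply/homogz_homog; rewrite -ja.
    apply: homogz_sum => b; rewrite mxE -[gdeg a](subrK (gdeg b)).
    by apply: homogzM (fd b); apply: gdiff_homog.
  rewrite scaler_sumr; apply: eq_bigr => b _.
  by rewrite !mxE -mul_mpolyC mulrA.
(* That [c] is a cycle after reduction means that [v] has no constant terms. *)
have /fin_all_exists[h' h'E] b : exists h' : 'I_n.+1 -> {mpoly k[n.+1]},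
    v 0 b = \sum_i 'X_i * h' i.
  apply: mpoly_const0; move/rowP: cD => /(_ b); rewrite !mxE => cD.
  rewrite -[RHS]cD raddf_sum; apply: eq_bigr => a _.
  by rewrite /= !mxE mcoeffCM.
(* Adding [r i *: u] makes the augmentation of [om i] the class of [q i], which is zero; as
   [\sum_i 'X_i * r i = 0], the total is still [v]. *)
pose r i := val (q i) - \sum_b h' b i * f b.
pose om i : 'rV_(grank F 0) := \row_b h' b i + r i *: u.
have om0 i : aug (om i) = 0.
  have -> : aug (om i) = \pi_{ideal_quot I} (val (q i)).
    rewrite augE.
    have -> : sigma (om i) = \sum_b h' b i * f b + r i * sigma u.
      rewrite /sigma mulr_sumr -big_split; apply: eq_bigr => b _.
      by rewrite !mxE mulrDl mulrA.
    have u1 : \pi_{ideal_quot I} (sigma u) = 1 by rewrite -augE; apply/esym.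
    by rewrite rmorphD rmorphM /= u1 mulr1 -rmorphD addrC subrK.
  by apply/eqP; rewrite pi_eq0 -VI.
have r0 : \sum_i 'X_i * r i = 0.
  under eq_bigr => i _ do rewrite mulrBr mulr_sumr.
  rewrite sumrB -sv exchange_big; apply/eqP; rewrite subr_eq0; apply/eqP.
  apply: eq_bigr => b _; rewrite h'E mulr_suml; apply: eq_bigr => i _.
  by rewrite mulrA.
have vE : v = \sum_i 'X_i *: om i.
  apply/rowP => b; rewrite summxE h'E.
  under [RHS]eq_bigr => i _ do rewrite !mxE mulrDr mulrA.
  by rewrite big_split /= -mulr_suml r0 mul0r addr0.
have /fin_all_exists[w wE] i : exists w, om i = w *m D0.
  exact: iffLR (gexact0 (g := F) _) (om0 i).
(* Subtracting [\sum_i 'X_i *: w i] turns the lift of [c] into a cycle over [R] without changing its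
   constant terms; exactness then makes [c] the reduction of a boundary. *)
have /(gexactS (g := F))[y yE] : (map_mx (@mpolyC n.+1 k) c - \sum_i 'X_i *: w i) *m D0 = 0.
  rewrite mulmxBl -/v vE mulmx_suml -sumrB big1 // => i _.
  by rewrite -scalemxAl -wE subrr.
have {yE} cE : c = map_mx (mcoeff 0%MM) y *m tor_diff F 1.
  rewrite -map_mxM -yE; apply/rowP => a; rewrite 2!mxE raddfD /= mxE.
  rewrite mcoeffC eqxx mulr1 mxE summxE raddfN raddf_sum /= big1 ?subr0 // => i _.
  by rewrite mxE rmorphM /= mcoeffX -mdeg_eq0 mdeg1 mul0r.
rewrite -cT cE -mulmxA -tor_part_diff mulmxA -mulmxA; apply: submxMl.
Qed.

End Tor1.

Theorem proposition7p1 (k : fieldType) (s : nat) (s_ge3 : (3 <= s)%N)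
    (I : idealr {mpoly k[3]})
    (I_homogeneous : homogeneous_ideal I)
    (I_grade : has_grade I 3)
    (I_compressed : compressed I)
    (I_socle : socle_shifts I [tuple s; (2 * s - 1)%N])
    (F : graded_free_resolution I) :
  (tor_dim F 1 (s + 1)%N%:Z <= s + 2)%N.
Proof.
case: s => [//|d] in s_ge3 I_socle *; rewrite addn1 addn2.
rewrite (_ : 2 * d.+1 - 1 = (2 * d).+1)%N in I_socle; last lia.
have [V [W [VI WI VW]]] := ideal_growth s_ge3 I_homogeneous I_compressed I_socle.
by apply: leq_trans (tor1_dim_leq F I_homogeneous VI WI) _; rewrite leq_subLR.
Qed.
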